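(* Let $K$ be a Garside monoid with submonoids $G$ and $H$. Then $K=G\bowtie H$ if and only if $K$ can be written as a crossed product of the monoids $G$ and $H$.
   Context: Zappa–Szép product: for a monoid $K$ with submonoids $G,H$, write $K=G\bowtie H$ if for every $k\in K$ there exist unique $g_1,g_2\in G$ and $h_1,h_2\in H$ such that $g_1h_1=k=h_2g_2$. Garside monoids: in a monoid $M$ with identity $\mathbf 1$, write $x\preccurlyeq y$ ($x$ is a prefix of $y$) if $y=xu$ for some $u\in M$, and $y\succcurlyeq x$ ($x$ is a suffix of $y$) if $y=ux$ for some $u\in M$. An atom is an element $a\neq\mathbf 1$ such that $a=uv$ implies $u=\mathbf 1$ or $v=\mathbf 1$. $M$ is atomic if it is generated by its atoms and for each $x\in M$ there is an upper bound on the lengths of decompositions of $x$ as a product of atoms. An element is balanced if its set of prefixes equals its set of suffixes; this common set is denoted $\mathrm{Div}(d)$. A Garside structure is a pair $(M,\Delta)$ where $M$ is a cancellative atomic monoid, the prefix and suffix relations are lattice orders, $\Delta\in M$ is balanced, $M$ is generated by $\mathrm{Div}(\Delta)$, and $\mathrm{Div}(\Delta)$ is finite. $M$ is a Garside monoid if such a $\Delta$ exists. A monoid is conical if $xy=\mathbf 1$ implies $x=\mathbf 1=y$. Crossed products: let $G$ and $H$ be cancellative, conical monoids with finitely many atoms, and let $\Theta_{1,2}:G\times H\to H$ and $\Theta_{2,1}:H\times G\to G$ be maps such that (CP-a) for all $g\in G$ and $h\in H$, the maps $h'\mapsto\Theta_{1,2}(g,h')$ and $g'\mapsto\Theta_{2,1}(h,g')$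 are bijections (of $H$ and $G$, respectively); (CP-b) for all $g,g_1,g_2\in G$ and $h,h_1,h_2\in H$: $\Theta_{1,2}(g_1g_2,h)=\Theta_{1,2}(g_2,\Theta_{1,2}(g_1,h))$, $\Theta_{2,1}(h_1h_2,g)=\Theta_{2,1}(h_2,\Theta_{2,1}(h_1,g))$, $\Theta_{1,2}(g,h_1h_2)=\Theta_{1,2}(g,h_1)\,\Theta_{1,2}(\Theta_{2,1}(h_1,g),h_2)$, $\Theta_{2,1}(h,g_1g_2)=\Theta_{2,1}(h,g_1)\,\Theta_{2,1}(\Theta_{1,2}(g_1,h),g_2)$. The crossed product $G\bowtie_\Theta H$ is the quotient of the free product of the monoids $G$ and $H$ by the relations $g\,\Theta_{1,2}(g,h)=h\,\Theta_{2,1}(h,g)$ for all $g\in G$, $h\in H$. For submonoids $G,H$ of $K$, ''$K$ can be written as a crossed product of $G$ and $H$'' means that $G$ and $H$ are cancellative and conical with finitely many atoms, and there are such maps $\Theta_{1,2},\Theta_{2,1}$ for which the inclusions of $G$ and $H$ into $K$ induce an isomorphism $G\bowtie_\Theta H\to K$. *)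

(* Defs.v *)
From HB Require Import structures.
From mathcomp Require Import all_boot generic_quotient.
From mathcomp Require Import boolp classical_sets cardinality.

Set Implicit Arguments.
Unset Strict Implicit.
Unset Printing Implicit Defensive.

Local Open Scope classical_set_scope.
Local Open Scope quotient_scope.
Local Open Scope group_scope.

Section MonoidProperties.
Variable M : monoidType.
Implicit Types (x y d a u v : M) (S : set M).

Definition mprefix x y : Prop := exists u, y = x * u.
Definition msuffix x y : Prop := exists u, y = u * x.

Definition cancellative : Prop :=
  (forall x y z : M, x * y = x * z -> y = z) /\
  (forall x y z : M, y * x = z * x -> y = z).

Definition conical : Prop := forall x y, x * y = 1 -> x = 1 /\ y = 1.

Definition atoms : set M :=
  [set a | a <> 1 /\ forall u v, a = u * v -> u = 1 \/ v = 1].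

(* [factorization S x s]: the sequence s of elements of S has product x. *)
Definition factorization S x (s : seq M) : Prop :=
  (forall a, a \in s -> S a) /\ x = \prod_(a <- s) a.

Definition generated_by S : Prop := forall x, exists s, factorization S x s.

Definition atomic : Prop :=
  generated_by atoms /\
  forall x, exists n : nat, forall s, factorization atoms x s -> (size s <= n)%N.

Definition balanced d : Prop :=
  [set x | mprefix x d] = [set x | msuffix x d].

(* Meaningful as Div(d) when d is balanced. *)
Definition Div d : set M := [set x | mprefix x d].

End MonoidProperties.

Arguments atoms M : clear implicits.

Definition lattice_order (T : Type) (R : T -> T -> Prop) : Prop :=
  [/\ (forall x, R x x),
      (forall x y, R x y -> R y x -> x = y),
      (forall x y z, R x y -> R y z -> R x z),
      (forall x y, exists m, [/\ R m x, R m y &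
         forall z, R z x -> R z y -> R z m])
    & (forall x y, exists j, [/\ R x j, R y j &
         forall z, R x z -> R y z -> R j z])].

Record garside_structure (M : monoidType) (Delta : M) : Prop := {
  garside_cancellative : cancellative M;
  garside_atomic : atomic M;
  garside_prefix_lattice : lattice_order (@mprefix M);
  garside_suffix_lattice : lattice_order (@msuffix M);
  garside_balanced : balanced Delta;
  garside_generated : generated_by (Div Delta);
  garside_finite : finite_set (Div Delta)
}.

Definition garside_monoid (M : monoidType) : Prop :=
  exists Delta : M, garside_structure Delta.

(* A submonoid of K is a value of [umagmaClosed K] (a subset containing 1 and
   closed under products, Boolean-valued as are all MathComp predicates, which
   classically is no restriction); [submonoid G] is the monoid of its elements. *)
Section Submonoid.
Variables (K : monoidType) (G : umagmaClosed K).

Record submonoid : Type := Submonoid {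
  submonoid_val :> K;
  _ : submonoid_val \in G
}.

HB.instance Definition _ := [isSub for submonoid_val].
HB.instance Definition _ := [Choice of submonoid by <:].

Fact submonoid_closed : monoid_closed G.
Proof. by split; [exact: gpred1 | exact: gpredM]. Qed.

HB.instance Definition _ :=
  SubChoice_isSubMonoid.Build K (mem G) submonoid submonoid_closed.
End Submonoid.

(* The quadruple (g1, h1, h2, g2) is unique as a whole, which is the same as
   uniqueness of each of the two factorizations. *)
Definition zappa_szep (K : monoidType) (G H : umagmaClosed K) : Prop :=
  forall k : K,
  exists! q : (submonoid G * submonoid H) * (submonoid H * submonoid G),
    let: ((g1, h1), (h2, g2)) := q in
    (g1 : K) * (h1 : K) = k /\ k = (h2 : K) * (g2 : K).

Section QuotientMonoid.
Variables (M : monoidType) (R : M -> M -> Prop).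

(* The least congruence on M containing R. *)
Inductive gcongr : M -> M -> Prop :=
| gcongr_gen x y : R x y -> gcongr x y
| gcongr_refl x : gcongr x x
| gcongr_sym x y : gcongr x y -> gcongr y x
| gcongr_trans x y z : gcongr x y -> gcongr y z -> gcongr x z
| gcongr_mul x y x' y' :
    gcongr x y -> gcongr x' y' -> gcongr (x * x') (y * y').

Definition gcongr_rel : rel M := fun x y => `[< gcongr x y >].

Fact gcongr_rel_refl : reflexive gcongr_rel.
Proof. by move=> x; apply/asboolP; exact: gcongr_refl. Qed.

Fact gcongr_rel_sym : symmetric gcongr_rel.
Proof.
by move=> x y; apply/asboolP/asboolP; exact: gcongr_sym.
Qed.

Fact gcongr_rel_trans : transitive gcongr_rel.
Proof.
by move=> y x z /asboolP xy /asboolP yz; apply/asboolP;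
  exact: gcongr_trans yz.
Qed.

Canonical gcongr_equiv :=
  EquivRel gcongr_rel
    gcongr_rel_refl gcongr_rel_sym gcongr_rel_trans.

Definition quotient_monoid : Type := {eq_quot gcongr_equiv}.

HB.instance Definition _ := Choice.on quotient_monoid.

Definition quotient_proj (x : M) : quotient_monoid :=
  (\pi_{eq_quot gcongr_equiv} x)%qT.

Definition quotient_repr (a : quotient_monoid) : M :=
  @repr M {eq_quot gcongr_equiv} a.

Lemma quotient_projP x y :
  quotient_proj x = quotient_proj y <-> gcongr x y.
Proof.
by split=> [/eqmodP/asboolP | xy]; last by apply/eqmodP/asboolP.
Qed.

Lemma quotient_reprK : cancel quotient_repr quotient_proj.
Proof. by move=> a; rewrite /quotient_proj reprK. Qed.

Definition quotient_mul (a b : quotient_monoid) : quotient_monoid :=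
  quotient_proj (quotient_repr a * quotient_repr b).

Lemma quotient_mulE x y :
  quotient_mul (quotient_proj x) (quotient_proj y) = quotient_proj (x * y).
Proof.
by apply/quotient_projP/gcongr_mul; apply/quotient_projP;
  rewrite quotient_reprK.
Qed.

Fact quotient_mulA : associative quotient_mul.
Proof.
move=> a b c; rewrite -(quotient_reprK a) -(quotient_reprK b).
by rewrite -(quotient_reprK c) !quotient_mulE mulgA.
Qed.

Fact quotient_mul1 : left_id (quotient_proj 1) quotient_mul.
Proof. by move=> a; rewrite -(quotient_reprK a) quotient_mulE mul1g. Qed.

Fact quotient_mulr1 : right_id (quotient_proj 1) quotient_mul.
Proof. by move=> a; rewrite -(quotient_reprK a) quotient_mulE mulg1. Qed.

HB.instance Definition _ :=
  isMonoid.Build quotient_monoid quotient_mulA quotient_mul1 quotient_mulr1.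
End QuotientMonoid.

Section FreeMonoid.
Variable T : choiceType.

Definition free_monoid : Type := seq T.

HB.instance Definition _ := Choice.on free_monoid.
HB.instance Definition _ :=
  isMonoid.Build free_monoid (@catA T) (@cat0s T) (@cats0 T).
End FreeMonoid.

(* The free product of G and H is the monoid of words on the disjoint union of
   G and H, modulo multiplication inside each factor and removal of units. *)
Section FreeProduct.
Variables G H : monoidType.

Let word : monoidType := free_monoid (G + H)%type.

Inductive free_product_relation : word -> word -> Prop :=
| free_product_mull (g g' : G) :
    free_product_relation [:: inl g; inl g'] [:: inl (g * g')]
| free_product_onel : free_product_relation [:: inl 1] [::]
| free_product_mulr (h h' : H) :
    free_product_relation [:: inr h; inr h'] [:: inr (h * h')]
| free_product_oner : free_product_relation [:: inr 1] [::].

Definition free_product : monoidType := quotient_monoid free_product_relation.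

Definition free_inl (g : G) : free_product :=
  quotient_proj free_product_relation [:: inl g].
Definition free_inr (h : H) : free_product :=
  quotient_proj free_product_relation [:: inr h].
End FreeProduct.

Arguments free_inl {G} H g.
Arguments free_inr G {H} h.

Section CrossedProduct.
Variables (G H : monoidType) (Theta12 : G -> H -> H) (Theta21 : H -> G -> G).

Record crossed_maps : Prop := {
  crossed_bij12 : forall g, bijective (Theta12 g);
  crossed_bij21 : forall h, bijective (Theta21 h);
  crossed_act12 : forall g1 g2 h,
    Theta12 (g1 * g2) h = Theta12 g2 (Theta12 g1 h);
  crossed_act21 : forall h1 h2 g,
    Theta21 (h1 * h2) g = Theta21 h2 (Theta21 h1 g);
  crossed_mul12 : forall g h1 h2,
    Theta12 g (h1 * h2) = Theta12 g h1 * Theta12 (Theta21 h1 g) h2;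
  crossed_mul21 : forall h g1 g2,
    Theta21 h (g1 * g2) = Theta21 h g1 * Theta21 (Theta12 g1 h) g2
}.

Inductive crossed_relation : free_product G H -> free_product G H -> Prop :=
| CrossedRelation (g : G) (h : H) :
    crossed_relation (free_inl H g * free_inr G (Theta12 g h))
                     (free_inr G h * free_inl H (Theta21 h g)).

Definition crossed_product : monoidType := quotient_monoid crossed_relation.

Definition crossed_inl (g : G) : crossed_product :=
  quotient_proj crossed_relation (free_inl H g).
Definition crossed_inr (h : H) : crossed_product :=
  quotient_proj crossed_relation (free_inr G h).
End CrossedProduct.

Definition crossed_factor (M : monoidType) : Prop :=
  [/\ cancellative M, conical M & finite_set (atoms M)].

(* A monoid morphism f out of the crossed product is determined by its values
   on G and H, so "the inclusions induce an isomorphism" says that some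
   bijective morphism f extends both inclusions. *)
Definition is_crossed_product (K : monoidType) (G H : umagmaClosed K) : Prop :=
  [/\ crossed_factor (submonoid G), crossed_factor (submonoid H) &
   exists (Theta12 : submonoid G -> submonoid H -> submonoid H)
          (Theta21 : submonoid H -> submonoid G -> submonoid G),
     crossed_maps Theta12 Theta21 /\
     exists f : crossed_product Theta12 Theta21 -> K,
       [/\ monoid_morphism f,
           forall g : submonoid G, f (crossed_inl Theta12 Theta21 g) = g :> K,
           forall h : submonoid H, f (crossed_inr Theta12 Theta21 h) = h :> K
         & bijective f]].

(* Main.v *)
(* If K = G |><| H, uniqueness of the factorizations and conicality make G and H
   closed under factors in K, so their atoms are atoms of K.  The same argument
   shows that the right lcm of g in G and h in H has the form g h' = h g' with h'
   in H and g' in G, and that this is the only equality of this form; the maps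
   (g, h) |-> h' and (g, h) |-> g' are Theta12 and Theta21, their inverses being
   given by the factorizations of g h' in H G and of h g' in G H.
   Conversely, every crossed product acts on the set G x H, which makes the
   factorization x = g h of each of its elements unique. *)
Require Import Defs.
From mathcomp Require Import all_boot.
From mathcomp Require Import boolp classical_sets cardinality.

Set Implicit Arguments.
Unset Strict Implicit.
Unset Printing Implicit Defensive.

Local Open Scope group_scope.

(** * Actions of a monoid passing to quotients *)

Section Congruence.
Variables (M : monoidType) (R : M -> M -> Prop).

Lemma quotient_projM x y :
  quotient_proj R (x * y) = quotient_proj R x * quotient_proj R y.
Proof. exact: esym (quotient_mulE R x y). Qed.

(** Acting by the same map is itself a congruence, so it contains the least congruence as soon as it
    contains [R]. *)
Lemma gcongr_act (X : Type) (act : M -> X -> X) :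
    (forall x y p, act (x * y) p = act x (act y p)) ->
    (forall x y, R x y -> act x =1 act y) ->
  forall x y, gcongr R x y -> act x =1 act y.
Proof.
move=> actM actR x y.
elim=> {x y} [x y /actR // | // | x y _ IH p | x y z _ IH1 _ IH2 p
             | x y x' y' _ IH1 _ IH2 p].
- by rewrite IH.
- by rewrite IH1 IH2.
- by rewrite !actM IH2 IH1.
Qed.

Lemma quotient_act (X : Type) (act : M -> X -> X) :
    (forall x y p, act (x * y) p = act x (act y p)) ->
    (forall x y, R x y -> act x =1 act y) ->
  exists act' : quotient_monoid R -> X -> X,
    (forall a b p, act' (a * b) p = act' a (act' b p)) /\
    (forall x, act' (quotient_proj R x) =1 act x).
Proof.
move=> actM actR; pose act' (a : quotient_monoid R) := act (quotient_repr a).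
have act'E x : act' (quotient_proj R x) =1 act x.
  apply: (gcongr_act actM actR); apply/quotient_projP.
  exact: quotient_reprK.
exists act'; split=> // a b p.
rewrite -[a]quotient_reprK -[b]quotient_reprK -quotient_projM.
by rewrite !act'E actM.
Qed.

End Congruence.

(** * Crossed products: induction, actions and normal forms *)

Section CrossedProductTheory.
Variables (G H : monoidType).
Variables (Theta12 : G -> H -> H) (Theta21 : H -> G -> G).

Local Notation inl := (crossed_inl Theta12 Theta21).
Local Notation inr := (crossed_inr Theta12 Theta21).

Lemma crossed_inl1 : inl 1 = 1.
Proof.
congr quotient_proj; apply/quotient_projP/gcongr_gen.
exact: free_product_onel.
Qed.

Lemma crossed_inlM g g' : inl (g * g') = inl g * inl g'.
Proof.
rewrite -quotient_projM; congr quotient_proj.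
rewrite -quotient_projM; apply/quotient_projP/gcongr_sym/gcongr_gen.
exact: free_product_mull.
Qed.

Lemma crossed_inr1 : inr 1 = 1.
Proof.
congr quotient_proj; apply/quotient_projP/gcongr_gen.
exact: free_product_oner.
Qed.

Lemma crossed_inrM h h' : inr (h * h') = inr h * inr h'.
Proof.
rewrite -quotient_projM; congr quotient_proj.
rewrite -quotient_projM; apply/quotient_projP/gcongr_sym/gcongr_gen.
exact: free_product_mulr.
Qed.

Lemma crossed_commute g h :
  inl g * inr (Theta12 g h) = inr h * inl (Theta21 h g).
Proof.
rewrite -[LHS]quotient_projM -[RHS]quotient_projM.
apply/quotient_projP/gcongr_gen.
exact: CrossedRelation.
Qed.

(** An element of this double quotient is represented by a word in letters from [G] and [H]; the
    induction is on that word. *)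
Lemma crossed_product_ind (P : crossed_product Theta12 Theta21 -> Prop) :
    P 1 -> (forall g x, P x -> P (inl g * x)) ->
    (forall h x, P x -> P (inr h * x)) ->
  forall x, P x.
Proof.
move=> P1 Pl Pr x; rewrite -[x]quotient_reprK -[quotient_repr x]quotient_reprK.
elim: (quotient_repr (quotient_repr x)) => [//|[g|h] w Pw].
- move: (Pl g _ Pw); rewrite -quotient_projM /free_inl.
  by rewrite -[free_inl _ _ * _]quotient_projM.
- move: (Pr h _ Pw); rewrite -quotient_projM /free_inr.
  by rewrite -[free_inr _ _ * _]quotient_projM.
Qed.

(** Universal property in terms of actions: words act letter by letter, and the action descends
    first to the free product, then to the crossed product. *)
Lemma crossed_product_act (X : Type) (actG : G -> X -> X) (actH : H -> X -> X) :
    (forall p, actG 1 p = p) ->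
    (forall g g' p, actG (g * g') p = actG g (actG g' p)) ->
    (forall p, actH 1 p = p) ->
    (forall h h' p, actH (h * h') p = actH h (actH h' p)) ->
    (forall g h p,
       actG g (actH (Theta12 g h) p) = actH h (actG (Theta21 h g) p)) ->
  exists act : crossed_product Theta12 Theta21 -> X -> X,
    [/\ forall x y p, act (x * y) p = act x (act y p),
        forall g, act (inl g) =1 actG g
      & forall h, act (inr h) =1 actH h].
Proof.
move=> G1 GM H1 HM GH.
pose letter (s : (G + H)%type) :=
  match s with Datatypes.inl g => actG g | Datatypes.inr h => actH h end.
pose wact (w : free_monoid (G + H)%type) p := foldr letter p w.
have wactM (v w : free_monoid (G + H)%type) p :
  wact (v * w) p = wact v (wact w p) by exact: foldr_cat.
have [|fact [factM factE]] :=
    @quotient_act _ (@free_product_relation G H) _ wact wactM.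
  by move=> x y [g g'||h h'|] p /=; rewrite ?GM ?HM ?G1 ?H1.
have [|act [actM actE]] :=
    @quotient_act _ (crossed_relation Theta12 Theta21) _ fact factM.
  move=> x y [g h] p; rewrite !factM !factE /=; exact: GH.
by exists act; split=> // [g|h] p; rewrite actE factE.
Qed.

Hypothesis Theta_maps : crossed_maps Theta12 Theta21.

Lemma crossed_productGH x : exists g h, x = inl g * inr h.
Proof.
elim/crossed_product_ind: x => [|g x [g' [h ->]]|h x [g [h' ->]]].
- by exists 1, 1; rewrite crossed_inl1 crossed_inr1 mulg1.
- by exists (g * g'), h; rewrite crossed_inlM mulgA.
(* By surjectivity of [Theta21 h], the factor [g] is some [Theta21 h a], so [h g] becomes
   [a (Theta12 a h)]. *)
- have [inv _ ThetaK] := crossed_bij21 Theta_maps h.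
  exists (inv g), (Theta12 (inv g) h * h').
  by rewrite crossed_inrM [RHS]mulgA crossed_commute ThetaK mulgA.
Qed.

Lemma crossed_productHG x : exists h g, x = inr h * inl g.
Proof.
have [g [h ->]] := crossed_productGH x.
have [inv _ ThetaK] := crossed_bij12 Theta_maps g.
by exists (inv h), (Theta21 (inv h) g); rewrite -crossed_commute ThetaK.
Qed.

Hypotheses (cancelG : cancellative G) (cancelH : cancellative H).

(** [Theta12 1] is idempotent by the action law, and an injective idempotent map is the identity. *)
Lemma crossed_1_12 h : Theta12 1 h = h.
Proof.
apply: (bij_inj (crossed_bij12 Theta_maps 1)).
by rewrite -(crossed_act12 Theta_maps) mulg1.
Qed.

Lemma crossed_1_21 g : Theta21 1 g = g.
Proof.
apply: (bij_inj (crossed_bij21 Theta_maps 1)).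
by rewrite -(crossed_act21 Theta_maps) mulg1.
Qed.

(** As [Theta21 1 g = g], the product law makes [Theta12 g 1] an idempotent, which cancellation
    forces to be [1]. *)
Lemma crossed_12_1 g : Theta12 g 1 = 1.
Proof.
apply: (cancelH.1 (Theta12 g 1)); rewrite mulg1.
by rewrite -{2}(crossed_1_21 g) -(crossed_mul12 Theta_maps) mulg1.
Qed.

Lemma crossed_21_1 h : Theta21 h 1 = 1.
Proof.
apply: (cancelG.1 (Theta21 h 1)); rewrite mulg1.
by rewrite -{2}(crossed_1_12 h) -(crossed_mul21 Theta_maps) mulg1.
Qed.

(* Letters act on pairs [(g, h)] as left multiplication acts on the formal
   products [g h]: a letter [k] of [H] is moved past [g] by [k g = a (Theta12 a k)]
   where [Theta21 k a = g].  The orbit of [(1, 1)] reads off the normal form. *)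
Lemma crossed_product_inj g h g' h' :
  inl g * inr h = inl g' * inr h' -> g = g' /\ h = h'.
Proof.
have /boolp.choice[inv /all_and2[ThetaK invK]] : forall k, exists inv,
    cancel (Theta21 k) inv /\ cancel inv (Theta21 k).
  by move=> k; have [i ? ?] := crossed_bij21 Theta_maps k; exists i.
have invP k a b : Theta21 k a = b -> inv k b = a by move=> <-; exact: ThetaK.
pose actG a (p : G * H) := (a * p.1, p.2).
pose actH k (p : G * H) := (inv k p.1, Theta12 (inv k p.1) k * p.2).
have [||||| act [actM actl actr]] := @crossed_product_act _ actG actH.
- by move=> [a k]; rewrite /actG mul1g.
- by move=> a a' p; rewrite /actG mulgA.
- move=> [a k]; rewrite /actH /= (invP 1 a a) ?crossed_1_21 //.
  by rewrite crossed_12_1 mul1g.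
- move=> k k' [a l]; rewrite /actH /=.
  rewrite (invP (k * k') (inv k (inv k' a))).
    by rewrite (crossed_mul12 Theta_maps) invK mulgA.
  by rewrite (crossed_act21 Theta_maps) !invK.
- move=> a k [b l]; rewrite /actG /actH /=.
  rewrite (invP k (a * inv (Theta12 a k) b)).
    by rewrite (crossed_act12 Theta_maps).
  by rewrite (crossed_mul21 Theta_maps) invK.
have act1 a k : act (inl a * inr k) (1, 1) = (a, k).
  rewrite actM actl actr /actG /actH /= (invP k 1) ?crossed_21_1 //.
  by rewrite crossed_1_12 !mulg1.
by move=> e; move: (act1 g h); rewrite e act1 => -[-> ->].
Qed.

(** Surjectivity of [Theta21] lets the crossed relation turn both sides into normal forms [g h];
    injectivity of [Theta12 a] then recovers [h]. *)
Lemma crossed_product_injHG h g h' g' :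
  inr h * inl g = inr h' * inl g' -> h = h' /\ g = g'.
Proof.
have [a <-] : exists a, Theta21 h a = g.
  by have [i _ iK] := crossed_bij21 Theta_maps h; exists (i g).
have [a' <-] : exists a, Theta21 h' a = g'.
  by have [i _ iK] := crossed_bij21 Theta_maps h'; exists (i g').
rewrite -!crossed_commute => /crossed_product_inj[<-].
by move/(bij_inj (crossed_bij12 Theta_maps a)) => <-.
Qed.

End CrossedProductTheory.

(** * Submonoids with unique factorizations *)

Section UniqueFactorization.
Variable K : monoidType.
Implicit Types A B : umagmaClosed K.

(** One order of the factors only, so that later arguments apply with the two submonoids
    exchanged. *)
Definition unique_factorization A B :=
  (forall k : K, exists (a : submonoid A) (b : submonoid B),
     k = (a : K) * (b : K)) /\
  (forall (a a' : submonoid A) (b b' : submonoid B),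
     (a : K) * (b : K) = (a' : K) * (b' : K) -> a = a' /\ b = b').

(** A pair with product [k] extends to a quadruple by a factorization of [k] in the other order, so
    uniqueness of quadruples gives uniqueness of pairs. *)
Lemma zappa_szepE A B : zappa_szep A B <->
  unique_factorization A B /\ unique_factorization B A.
Proof.
split=> [zs | [[exAB unAB] [exBA unBA]] k]; last first.
  have [a [b kab]] := exAB k; have [b' [a' kba]] := exBA k.
  exists (a, b, (b', a')); split=> // -[[c d] [d' c']] [cdk kdc].
  by have [-> ->] := unAB a c b d (etrans (esym kab) (esym cdk));
    have [-> ->] := unBA b' d' a' c' (etrans (esym kba) kdc).
split; split=> [k | x x' y y' e].
- by have [[[a b] [b' a']] [[<- _] _]] := zs k; exists a, b.
- have [[[a b] [b' a']] [[_ kba] un]] := zs ((x : K) * (y : K)).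
  have [<- <-] := un (x, y, (b', a')) (conj erefl kba).
  by have [<- <-] := un (x', y', (b', a')) (conj (esym e) kba).
- by have [[[a b] [b' a']] [[_ ->] _]] := zs k; exists b', a'.
- have [[[a b] [b' a']] [[abk _] un]] := zs ((x : K) * (y : K)).
  have [<- <-] := un (a, b, (x, y)) (conj abk erefl).
  by have [<- <-] := un (a, b, (x', y')) (conj abk e).
Qed.

Lemma submonoid_mem A (a : submonoid A) : (a : K) \in A.
Proof. by case: a. Qed.

Variables A B : umagmaClosed K.
Hypotheses (AB : unique_factorization A B) (BA : unique_factorization B A).

Hypothesis conicalK : conical K.

Lemma factor_closed (a : submonoid A) x y : a = x * y :> K ->
  x \in A /\ y \in A.
Proof.
move=> axy; split.
(* Writing [x = b a1] and [a1 y = b' a2] gives [1 a = (b b') a2], whence [b b' = 1], and [b = 1] by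
   conicality. *)
- have [b [a1 xE]] := BA.1 x; have [b' [a2 yE]] := BA.1 ((a1 : K) * y).
  have [/(congr1 val)/esym /= /conicalK[b1 _] _] : 1 = b * b' /\ a = a2.
    by apply: BA.2; rewrite /= mul1g axy xE -!mulgA yE.
  by rewrite xE b1 mul1g submonoid_mem.
- have [a1 [b yE]] := AB.1 y; have [a2 [b' xE]] := AB.1 (x * (a1 : K)).
  have [_ /(congr1 val)/esym /= /conicalK[_ b1]] : a = a2 /\ 1 = b' * b.
    by apply: AB.2; rewrite /= mulg1 axy yE !mulgA xE.
  by rewrite yE b1 mulg1 submonoid_mem.
Qed.

Lemma submonoid_atom (a : submonoid A) :
  atoms (submonoid A) a -> atoms K a.
Proof.
move=> [a1 atom_a]; split=> [/= e | u v /= e]; first by apply/a1/val_inj.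
have [uA vA] := factor_closed e.
have [|/(congr1 val)|/(congr1 val)] := atom_a (Submonoid uA) (Submonoid vA).
- exact: val_inj.
- by left.
- by right.
Qed.

Lemma submonoid_conical : conical (submonoid A).
Proof.
by move=> x y /(congr1 val) /= /conicalK[x1 y1]; split; apply: val_inj.
Qed.

Hypothesis cancelK : cancellative K.

Lemma submonoid_cancellative : cancellative (submonoid A).
Proof.
split=> x y z /(congr1 val) /= e; apply: val_inj.
  exact: cancelK.1 e.
exact: cancelK.2 e.
Qed.

Lemma submonoid_crossed_factor :
  finite_set (atoms K) -> crossed_factor (submonoid A).
Proof.
move=> finK; split; [exact: submonoid_cancellative|exact: submonoid_conical|].
apply: sub_finite_set (finite_preimage _ finK) => [a|]; last first.
  by move=> x y _ _; exact: val_inj.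
exact: submonoid_atom.
Qed.

(** Let [u = b1 a1]. Comparing factorizations of [m] shows that [a b1] is already a common multiple
    of [a] and [b], so leastness of [m] forces [a1 = 1]. *)
Lemma lcm_complement_mem (a : submonoid A) (b : submonoid B) m u :
  m = (a : K) * u -> mprefix (b : K) m ->
  (forall z, mprefix (a : K) z -> mprefix (b : K) z -> mprefix m z) ->
  u \in B.
Proof.
move=> mE [v mE'] least.
have [b1 [a1 uE]] := BA.1 u; have [b2 [a2 vE]] := BA.1 v.
have [b3 [a3 ab1]] := BA.1 ((a : K) * (b1 : K)).
have [/(congr1 val) /= e _] : b3 = b * b2 /\ a3 * a1 = a2.
  by apply: BA.2; rewrite /= mulgA -ab1 -mulgA -uE -mE mE' vE mulgA.
have [||w] := least ((a : K) * (b1 : K)).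
- by exists b1.
- by exists ((b2 : K) * (a3 : K)); rewrite ab1 e mulgA.
rewrite mE uE -!mulgA => /cancelK.1 b1E.
have /conicalK[-> _] : (a1 : K) * w = 1.
  by apply: (cancelK.1 b1); rewrite -b1E mulg1.
by rewrite mulg1 submonoid_mem.
Qed.

End UniqueFactorization.

(** * From unique factorizations to a crossed product *)

Section FactorizationToCrossedProduct.
Variables (K : monoidType) (G H : umagmaClosed K).
Hypotheses (GH : unique_factorization G H) (HG : unique_factorization H G).
Hypotheses (conicalK : conical K) (cancelK : cancellative K).
Hypothesis lcmK : forall x y : K, exists m, [/\ mprefix x m, mprefix y m &
  forall z, mprefix x z -> mprefix y z -> mprefix m z].

Lemma lcm_complement (g : submonoid G) (h : submonoid H) :
  exists q : submonoid H * submonoid G,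
    (g : K) * (q.1 : K) = (h : K) * (q.2 : K) /\
    forall q' : submonoid H * submonoid G,
      (g : K) * (q'.1 : K) = (h : K) * (q'.2 : K) -> q' = q.
Proof.
have [m [[u mu] [v mv] least]] := lcmK g h.
have uH : u \in H.
  by apply: (lcm_complement_mem HG conicalK cancelK mu _ least); exists v.
have vG : v \in G.
  apply: (lcm_complement_mem (b := g) GH conicalK cancelK mv); first by exists u.
  by move=> z hz gz; exact: least.
exists (Submonoid uH, Submonoid vG); split=> [|[h' g'] /= e] /=.
  by rewrite -mu.
(* Any other equality is the one from the lcm multiplied by some [w] on the right; closure under
   factors puts [w] in both [G] and [H]. *)
have [||w mw] := least ((g : K) * (h' : K)).
- by exists h'.
- by exists g'.
have hE : h' = u * w :> K.
  by apply: (cancelK.1 g); rewrite mw mu mulgA.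
have gE : g' = v * w :> K.
  by apply: (cancelK.1 h); rewrite -e mw mv mulgA.
have [_ wH] := factor_closed HG GH conicalK hE.
have [_ wG] := factor_closed GH HG conicalK gE.
(* The factorizations [w 1] and [1 w] of the same element agree, so [w = 1]. *)
have [/(congr1 val)/= w1 _] : Submonoid wG = 1 /\ 1 = Submonoid wH.
  by apply: GH.2; rewrite /= mulg1 mul1g.
by congr pair; apply: val_inj; rewrite /= ?hE ?gE w1 mulg1.
Qed.

(** Two commuting squares placed side by side form a commuting square, so uniqueness in
    [lcm_complement] yields the laws for products. *)
Lemma factorization_crossed_maps :
  exists (Theta12 : submonoid G -> submonoid H -> submonoid H)
         (Theta21 : submonoid H -> submonoid G -> submonoid G),
    (forall (g : submonoid G) (h : submonoid H),
       (g : K) * (Theta12 g h : K) = (h : K) * (Theta21 h g : K)) /\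
    crossed_maps Theta12 Theta21.
Proof.
have [T TP] := boolp.choice (fun p : submonoid G * submonoid H =>
  lcm_complement p.1 p.2).
pose T12 g h := (T (g, h)).1; pose T21 h g := (T (g, h)).2.
have TE (g : submonoid G) (h : submonoid H) :
    (g : K) * (T12 g h : K) = (h : K) * (T21 h g : K).
  exact: (TP (g, h)).1.
have TU (g : submonoid G) (h : submonoid H)
    (h' : submonoid H) (g' : submonoid G) :
    (g : K) * (h' : K) = (h : K) * (g' : K) ->
    h' = T12 g h /\ g' = T21 h g.
  by rewrite /T12 /T21 => e; rewrite -((TP (g, h)).2 (h', g') e).
have comp21 g1 g2 h :
    T12 (g1 * g2) h = T12 g2 (T12 g1 h) /\
    T21 h (g1 * g2) = T21 h g1 * T21 (T12 g1 h) g2.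
  have [|-> ->] // := TU (g1 * g2) h (T12 g2 (T12 g1 h))
                        (T21 h g1 * T21 (T12 g1 h) g2).
  by rewrite /= -mulgA TE !mulgA TE.
have comp12 h1 h2 g :
    T21 (h1 * h2) g = T21 h2 (T21 h1 g) /\
    T12 g (h1 * h2) = T12 g h1 * T12 (T21 h1 g) h2.
  have [|-> ->] // := TU g (h1 * h2) (T12 g h1 * T12 (T21 h1 g) h2)
                        (T21 h2 (T21 h1 g)).
  by rewrite /= mulgA TE -!mulgA TE.
exists T12, T21; split=> //; split.
- move=> g.
  have [inv invP] := boolp.choice (fun h' : submonoid H => HG.1 ((g : K) * (h' : K))).
  exists inv => h'.
    have [g' e] := invP (T12 g h'); rewrite TE in e.
    by have [] := HG.2 _ _ _ _ e.
  by have [g' /TU[<- _]] := invP h'.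
- move=> h.
  have [inv invP] := boolp.choice (fun g' : submonoid G => GH.1 ((h : K) * (g' : K))).
  exists inv => g'.
    have [h' e] := invP (T21 h g'); rewrite -TE in e.
    by have [] := GH.2 _ _ _ _ e.
  by have [h' /esym/TU[_ <-]] := invP g'.
- by move=> g1 g2 h; case: (comp21 g1 g2 h).
- by move=> h1 h2 g; case: (comp12 h1 h2 g).
- by move=> g h1 h2; case: (comp12 h1 h2 g).
- by move=> h g1 g2; case: (comp21 g1 g2 h).
Qed.

Lemma factorization_crossed_product :
  finite_set (atoms K) -> is_crossed_product G H.
Proof.
move=> finK; split.
- exact: (submonoid_crossed_factor GH HG).
- exact: (submonoid_crossed_factor HG GH).
have [T12 [T21 [TE Tmaps]]] := factorization_crossed_maps.
exists T12, T21; split=> //.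
(* The crossed product acts on [K], its letters by left multiplication; evaluating at [1] gives the
   morphism. *)
have [|||||act [actM actl actr]] := @crossed_product_act _ _ T12 T21 K
  (fun g k => (g : K) * k) (fun h k => (h : K) * k).
- by move=> p; rewrite /= mul1g.
- by move=> g g' p; rewrite /= mulgA.
- by move=> p; rewrite /= mul1g.
- by move=> h h' p; rewrite /= mulgA.
- by move=> g h p; rewrite !mulgA TE.
pose f x := act x 1.
have fE g h : f (crossed_inl T12 T21 g * crossed_inr T12 T21 h) =
    (g : K) * (h : K).
  by rewrite /f actM actl actr mulg1.
(* [act x] is left multiplication by [f x], which makes [f] multiplicative. *)
have actE x k : act x k = f x * k.
  have [g [h ->]] := crossed_productGH Tmaps x.
  by rewrite fE actM actl actr mulgA.
have fl g : f (crossed_inl T12 T21 g) = g by rewrite /f actl mulg1.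
exists f; split=> //.
- split; first by rewrite -(crossed_inl1 T12 T21) fl.
  by move=> x y; rewrite {1}/f actM actE.
- by move=> h; rewrite /f actr mulg1.
- have /boolp.choice[inv invE] : forall k, exists x, f x = k.
    move=> k; have [g [h ->]] := GH.1 k.
    by exists (crossed_inl T12 T21 g * crossed_inr T12 T21 h).
  exists inv => // x; have := invE (f x); move: (inv (f x)) => y.
  have [g [h ->]] := crossed_productGH Tmaps x.
  have [g' [h' ->]] := crossed_productGH Tmaps y.
  by rewrite !fE => /GH.2[-> ->].
Qed.

End FactorizationToCrossedProduct.

(** * From a crossed product to unique factorizations *)

Lemma crossed_product_factorization (K : monoidType) (G H : umagmaClosed K) :
  is_crossed_product G H ->
  unique_factorization G H /\ unique_factorization H G.
Proof.
move=> [[cancelG _ _] [cancelH _ _] [T12 [T21 [Tmaps [f [[_ fM] fl fr f_bij]]]]]].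
have [inv fK invK] := f_bij; have f_inj := can_inj fK.
split; split=> [k | x x' y y'].
- have [g [h e]] := crossed_productGH Tmaps (inv k).
  by exists g, h; rewrite -[k]invK e fM fl fr.
- rewrite -!fl -!fr -!fM => /f_inj.
  exact: (crossed_product_inj Tmaps cancelG cancelH).
- have [h [g e]] := crossed_productHG Tmaps (inv k).
  by exists h, g; rewrite -[k]invK e fM fl fr.
- rewrite -!fl -!fr -!fM => /f_inj.
  exact: (crossed_product_injHG Tmaps cancelG cancelH).
Qed.

(** * Conicality and atoms of Garside monoids, and the equivalence *)

(** If [x y = 1], then [x] and [1] are prefixes of each other. *)
Lemma prefix_antisym_conical (M : monoidType) :
  (forall x y : M, mprefix x y -> mprefix y x -> x = y) -> conical M.
Proof.
move=> anti x y xy1.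
have x1 : x = 1 by apply: anti; [exists y | exists x; rewrite mul1g].
by split=> //; rewrite -xy1 x1 mul1g.
Qed.

Lemma atoms_sub_generators (M : monoidType) (S : set M) :
  generated_by S -> (atoms M `<=` S)%classic.
Proof.
move=> gen a [a1 atom_a]; have [s [sS sE]] := gen a.
elim: s sS sE => [_ | x s IHs sS]; first by rewrite big_nil.
rewrite big_cons => aE; have [x1|s1] := atom_a _ _ aE.
  apply: IHs => [b bs|]; last by rewrite aE x1 mul1g.
  by apply: sS; rewrite in_cons bs orbT.
by rewrite aE s1 mulg1; apply: sS; rewrite mem_head.
Qed.

Theorem corollary33 (K : monoidType) (G H : umagmaClosed K)
    (hK : garside_monoid K) :
  zappa_szep G H <-> is_crossed_product G H.
Proof.
have [Delta [cancelK _ [_ anti _ _ lcmK] _ _ gen fin]] := hK.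
rewrite zappa_szepE; split=> [[GH HG] | ]; last first.
  exact: crossed_product_factorization.
apply: factorization_crossed_product => //.
  exact: prefix_antisym_conical.
exact: sub_finite_set (atoms_sub_generators gen) fin.
Qed.
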